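(* Let $d\ge1$ and $k\ge d+2$ be integers. Let $\pi_1,\dots,\pi_k>0$ with $\sum_{i=1}^k\pi_i=1$, let $\mu_1,\dots,\mu_k\in\mathbb{R}^d$, and let \[\rho(x)=\sum_{i=1}^k \frac{\pi_i}{\sqrt{(2\pi)^d}}\,e^{-\frac12\|x-\mu_i\|^2},\qquad x\in\mathbb{R}^d.\] Assume that the distances $\|\mu_i-\mu_j\|$, $1\le i<j\le k$, are pairwise distinct, and that the configuration $(\mu_1,\dots,\mu_k)$ is reconstructible from its multiset of pairwise distances. Then $\rho$ is uniquely reconstructible, up to a rigid motion, from its distribution of distances: if $\bar\pi_1,\dots,\bar\pi_k>0$ with $\sum_i\bar\pi_i=1$, $\nu_1,\dots,\nu_k\in\mathbb{R}^d$, and $\bar\rho(x)=\sum_{i=1}^k\frac{\bar\pi_i}{\sqrt{(2\pi)^d}}e^{-\frac12\|x-\nu_i\|^2}$ has the same distribution of distances as $\rho$, then there exists $g\in E(d)$ with $\rho(x)=\bar\rho(g\cdot x)$ for all $x\in\mathbb{R}^d$.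
   Context: $E(d)$ denotes the Euclidean group of rigid motions of $\mathbb{R}^d$ and $\|\cdot\|$ the Euclidean norm. For a probability density $\rho$ on $\mathbb{R}^d$, its distribution of distances is the probability density $r(\Delta)$ of the random variable $\Delta=\|x_1-x_2\|^2$, where $x_1,x_2$ are drawn independently according to $\rho$. A point configuration $p_1,\dots,p_k\in\mathbb{R}^d$ is called reconstructible from its multiset of pairwise distances if for every configuration $q_1,\dots,q_k\in\mathbb{R}^d$ whose multiset of pairwise distances equals that of $p_1,\dots,p_k$, there exist $g\in E(d)$ and a permutation $\sigma$ of $\{1,\dots,k\}$ with $g\cdot p_{\sigma(i)}=q_i$ for all $i$. *)

(* Defs.v *)
From HB Require Import structures.
From mathcomp Require Import all_boot all_order all_algebra all_fingroup.
From mathcomp Require Import all_classical all_reals all_analysis.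
Set Implicit Arguments. Unset Strict Implicit. Unset Printing Implicit Defensive.
Import Order.TTheory GRing.Theory Num.Theory.
Local Open Scope ring_scope.

Section Defs.
Variable R : realType.

Definition sqnorm (d : nat) (v : 'rV[R]_d) : R := \sum_(i < d) (v ord0 i) ^+ 2.
Definition edist (d : nat) (u v : 'rV[R]_d) : R := Num.sqrt (sqnorm (u - v)).

Definition rigid_motion (d : nat) (g : 'rV[R]_d -> 'rV[R]_d) : Prop :=
  exists (Q : 'M[R]_d) (b : 'rV[R]_d),
    Q *m Q^T = 1%:M /\ forall x, g x = x *m Q + b.

Definition pair_dists (d k : nat) (p : 'I_k -> 'rV[R]_d) : seq R :=
  [seq edist (p ij.1) (p ij.2) | ij <- enum [pred ij : 'I_k * 'I_k | (ij.1 < ij.2)%N]].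

Definition reconstructible (d k : nat) (p : 'I_k -> 'rV[R]_d) : Prop :=
  forall q : 'I_k -> 'rV[R]_d,
    perm_eq (pair_dists p) (pair_dists q) ->
    exists g, rigid_motion g /\ exists s : 'S_k, forall i, g (p (s i)) = q i.

Definition distinct_dists (d k : nat) (p : 'I_k -> 'rV[R]_d) : Prop :=
  forall i j i' j' : 'I_k, (i < j)%N -> (i' < j')%N ->
    edist (p i) (p j) = edist (p i') (p j') -> i = i' /\ j = j'.

Definition gmix (d k : nat) (w : 'I_k -> R) (m : 'I_k -> 'rV[R]_d)
  (x : 'rV[R]_d) : R :=
  \sum_(i < k) w i / Num.sqrt ((2 * pi) ^+ d) * expR (- (sqnorm (x - m i)) / 2).

(* Lebesgue integral over R^n of a nonnegative function, as the iterated
   integral of 1-d Lebesgue integrals (equal to the integral w.r.t. n-dim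
   Lebesgue measure by Tonelli). *)
Definition ncons (t : R) (s : nat -> R) : nat -> R :=
  fun n => if n is n'.+1 then s n' else t.

Fixpoint iint (n : nat) (f : (nat -> R) -> \bar R) : \bar R :=
  match n with
  | 0 => f (fun _ => 0)
  | n'.+1 => (\int[@lebesgue_measure R]_t iint n' (fun s => f (ncons t s)))%E
  end.

Definition rint (d : nat) (F : 'rV[R]_d -> \bar R) : \bar R :=
  iint d (fun s => F (\row_(i < d) s (nat_of_ord i))).

(* distribution (law) of Delta = ||x1 - x2||^2, x1, x2 i.i.d. with density rho:
   the probability that Delta lies in the Borel set A *)
Definition dist_of_dists (d : nat) (rho : 'rV[R]_d -> R)
  (A : set (measurableTypeR R)) : \bar R :=
  rint (fun x => rint (fun y =>
     ((\1_A (sqnorm (x - y)) : R) * (rho x * rho y))%:E)).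

End Defs.

(* Main.v *)
Require Import Defs.
From HB Require Import structures.
From mathcomp Require Import all_boot all_order all_algebra all_fingroup.
From mathcomp Require Import all_classical all_reals all_analysis.
From mathcomp Require Import measurable_realfun ring lra.
Import Order.TTheory GRing.Theory Num.Theory.
Local Open Scope ring_scope.

(* The law of Delta determines its Laplace transform. Since x1 - x2 is a Gaussian
   mixture, the latter equals, up to a positive factor depending only on s and d,
   the exponential sum  sum_(i, j) w_i w_j exp (- u |mu_i - mu_j|^2)  at
   u = s / (1 + 4 s).  Exponential sums agreeing on an interval have the same
   coefficients, so for each value of the distance the total weight w_i w_j of the
   pairs realizing it is determined.  As these are positive and the distances of
   mu are pairwise distinct, the distances of nu form the same multiset, and
   reconstructibility gives nu up to a rigid motion and a relabelling.  The
   products w_i w_j with i <> j are then determined too, hence, there being at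
   least three indices, so are the w_i. *)

(** * Squared norms and distances *)

Lemma sqnorm_ge0 {R : realType} d (v : 'rV[R]_d) : 0 <= sqnorm v.
Proof. by apply: sumr_ge0 => i _; exact: sqr_ge0. Qed.

Lemma sqnorm_eq0 {R : realType} d (v : 'rV[R]_d) : (sqnorm v == 0) = (v == 0).
Proof.
rewrite psumr_eq0; last by move=> i _; exact: sqr_ge0.
apply/allP/eqP => [v0|-> i _]; last by rewrite mxE expr0n/= eqxx.
apply/rowP => i; rewrite mxE; apply/eqP; rewrite -sqrf_eq0.
exact: (implyP (v0 i (mem_index_enum _))).
Qed.

Lemma sqnormBC {R : realType} d (u v : 'rV[R]_d) : sqnorm (u - v) = sqnorm (v - u).
Proof. by apply: eq_bigr => i _; rewrite !mxE -sqrrN opprB. Qed.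

Lemma sqnorm_mulmx {R : realType} d (Q : 'M[R]_d) (v : 'rV[R]_d) :
  Q *m Q^T = 1%:M -> sqnorm (v *m Q) = sqnorm v.
Proof.
have sqE (u : 'rV[R]_d) : sqnorm u = (u *m u^T) ord0 ord0.
  by rewrite mxE; apply: eq_bigr => i _; rewrite mxE expr2.
by move=> QQ; rewrite !sqE trmx_mul mulmxA -(mulmxA v) QQ mulmx1.
Qed.

Lemma sqnorm_rigid {R : realType} d (g : 'rV[R]_d -> 'rV[R]_d) u v :
  rigid_motion g -> sqnorm (g u - g v) = sqnorm (u - v).
Proof.
by move=> [Q [b [QQ gE]]]; rewrite !gE opprD addrACA subrr addr0 -mulmxBl sqnorm_mulmx.
Qed.

Lemma edist_eqE {R : realType} d (a b a' b' : 'rV[R]_d) :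
  (Defs.edist a b == Defs.edist a' b') = (sqnorm (a - b) == sqnorm (a' - b')).
Proof. by rewrite /Defs.edist eqr_sqrt ?sqnorm_ge0. Qed.

(** * Iterated integrals *)

(* Testing against all measurable maps avoids a sigma-algebra on [nat -> R]. *)
Definition jointly_measurable {R : realType} {d : measure_display}
    {T : measurableType d} (F : T -> (nat -> R) -> \bar R) :=
  forall (d' : measure_display) (T' : measurableType d') (a : T' -> T)
    (s : T' -> nat -> R),
    measurable_fun setT a -> (forall n, measurable_fun setT (fun z => s z n)) ->
    measurable_fun setT (fun z => F (a z) (s z)).

Lemma iint_ge0 {R : realType} n (f : (nat -> R) -> \bar R) :
  (forall s, 0 <= f s)%E -> (0 <= iint n f)%E.
Proof. by elim: n f => [|n IH] f f0 //=; apply: integral_ge0 => t _; exact: IH. Qed.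

Lemma eq_iint {R : realType} n (f g : (nat -> R) -> \bar R) :
  f =1 g -> iint n f = iint n g.
Proof. by move=> /funext ->. Qed.

Lemma measurable_ncons {R : realType} {d} {T : measurableType d} (t : T -> R)
    (s : T -> nat -> R) n :
  measurable_fun setT t -> (forall n, measurable_fun setT (fun z => s z n)) ->
  measurable_fun setT (fun z => Defs.ncons (t z) (s z) n).
Proof. by move=> mt ms; case: n => [|n]; [exact: mt|exact: ms]. Qed.

(** Absorbing the first coordinate into the parameter is what lets the inductions on the number of
    variables go through. *)
Lemma jointly_measurable_ncons {R : realType} {d} {T : measurableType d}
    (F : T -> (nat -> R) -> \bar R) :
  jointly_measurable F ->
  jointly_measurable
    (fun (p : T * measurableTypeR R) s => F p.1 (Defs.ncons p.2 s)).
Proof.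
move=> mF d' T' a s ma ms; apply: mF; first exact: measurableT_comp.
by move=> n; apply: measurable_ncons => //; exact: measurableT_comp.
Qed.

(** Induction on [n]: the outermost variable joins the parameter space, the induction hypothesis
    applies over the product of [T] with the real line, and Tonelli's theorem keeps measurability
    when that variable is integrated out. *)
Lemma measurable_iint {R : realType} n {d} {T : measurableType d}
    (F : T -> (nat -> R) -> \bar R) :
  (forall x s, 0 <= F x s)%E -> jointly_measurable F ->
  measurable_fun setT (fun x => iint n (F x)).
Proof.
elim: n d T F => [|n IH] d T F F0 mF /=; first exact: (mF _ _ id (fun _ _ => 0)).
apply: (measurable_fun_fubini_tonelli_F (m2 := lebesgue_measure)
  (fun p => iint n (fun s => F p.1 (Defs.ncons p.2 s)))).
  by apply: IH => [p s|]; [exact: F0|exact: jointly_measurable_ncons].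
by move=> p; apply: iint_ge0.
Qed.

(** Tonelli, one coordinate at a time: [v] is exchanged with the first coordinate, and induction
    handles the others. *)
Lemma integral_iint {R : realType} n (F : measurableTypeR R -> (nat -> R) -> \bar R) :
  (forall x s, 0 <= F x s)%E -> jointly_measurable F ->
  (\int[@lebesgue_measure R]_v iint n (F v) =
   iint n (fun s => \int[@lebesgue_measure R]_v F v s))%E.
Proof.
elim: n F => [//|n IH] F F0 mF /=.
rewrite (fubini_tonelli (m1 := lebesgue_measure) (m2 := lebesgue_measure)
  (fun p => iint n (fun s => F p.1 (Defs.ncons p.2 s)))).
- apply: eq_integral => t _ /=; apply: (IH (fun v s => F v (Defs.ncons t s))) => //.
  by move=> d' T' a s ma ms; apply: mF => // m; exact: measurable_ncons.
- by apply: measurable_iint => [p s|]; [exact: F0|exact: jointly_measurable_ncons].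
- by move=> p; exact: iint_ge0.
Qed.

(** * Measurability of mixtures and the layer cake formula *)

Lemma measurable_sum_ord {R : realType} {d} {T : measurableType d} n
    (F : 'I_n -> T -> R) :
  (forall i, measurable_fun setT (F i)) ->
  measurable_fun setT (fun z => \sum_(i < n) F i z).
Proof.
elim: n F => [|n IH] F mF.
  by under eq_fun do rewrite big_ord0; exact: measurable_cst.
under eq_fun do rewrite big_ord_recl.
by apply: measurable_funD => //; exact: IH.
Qed.

Lemma measurable_sqnormB {R : realType} {d} {T : measurableType d} n
    (x y : T -> 'rV[R]_n) :
  (forall i, measurable_fun setT (fun z => x z ord0 i)) ->
  (forall i, measurable_fun setT (fun z => y z ord0 i)) ->
  measurable_fun setT (fun z => sqnorm (x z - y z)).
Proof.
move=> mx my; apply: measurable_sum_ord => i.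
by under eq_fun do rewrite !mxE; apply: measurable_funX; exact: measurable_funB.
Qed.

Lemma measurable_gmix {R : realType} {d} {T : measurableType d} n k
    (w : 'I_k -> R) (m : 'I_k -> 'rV[R]_n) (x : T -> 'rV[R]_n) :
  (forall i, measurable_fun setT (fun z => x z ord0 i)) ->
  measurable_fun setT (fun z => gmix w m (x z)).
Proof.
move=> mx; apply: measurable_sum_ord => i; apply: measurable_funM => //.
apply: measurableT_comp => //; apply: measurable_funM => //.
by apply: measurableT_comp => //; apply: measurable_sqnormB.
Qed.

Lemma gmix_ge0 {R : realType} d k (w : 'I_k -> R) (m : 'I_k -> 'rV[R]_d) x :
  (forall i, 0 < w i) -> 0 <= gmix w m x.
Proof.
move=> w0; apply: sumr_ge0 => i _; rewrite mulr_ge0 ?expR_ge0//.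
by rewrite divr_ge0 ?sqrtr_ge0// ltW.
Qed.

Lemma measurable_indic_itv0 {R : realType} {d} {T : measurableType d} (v f : T -> R) :
  measurable_fun setT v -> measurable_fun setT f ->
  measurable_fun setT (fun z => \1_(`[0, f z]%classic : set R) (v z) : R).
Proof.
move=> mv mf.
rewrite [X in measurable_fun _ X](_ : _ =
  \1_([set z | 0 <= v z] `&` [set z | v z <= f z])); last first.
  by apply/funext => z; rewrite !indicE; congr (nat_of_bool _)%:R; apply/idP/idP;
    rewrite !inE/= in_itv/= => /andP.
apply: measurable_indic; apply: measurableI.
  by rewrite -[X in measurable X]setTI; apply: measurable_fun_le.
by rewrite -[X in measurable X]setTI; apply: measurable_fun_le.
Qed.

(** The same inequality is read as an event for the squared distance [r], then as a condition on the
    level [v], where it cuts out an interval of length [f r]. *)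
Lemma indic_layer {R : realType} (f : R -> R) (v r : R) :
  \1_[set t | 0 <= v <= f t]%classic r = \1_(`[0, f r]%classic : set R) v :> R.
Proof. by rewrite !indicE; congr (nat_of_bool _)%:R. Qed.

(* Layer cake: [f = \int 1_{0 <= v <= f} dv]. *)
Lemma layer_cake {R : realType} d (rho : 'rV[R]_d -> R) (f : R -> R) :
  (forall x, 0 <= rho x) -> measurable_fun setT f -> (forall t, 0 <= f t) ->
  (forall d' (T : measurableType d') (x : T -> 'rV[R]_d),
    (forall i, measurable_fun setT (fun z => x z ord0 i)) ->
    measurable_fun setT (fun z => rho (x z))) ->
  rint (fun x => rint (fun y => (f (sqnorm (x - y)) * (rho x * rho y))%:E)) =
  (\int[@lebesgue_measure R]_v
    dist_of_dists rho ([set t | (0 <= v <= f t)%R]%classic : set (measurableTypeR R)))%E.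
Proof.
move=> rho0 mf f0 mrho.
rewrite /dist_of_dists /rint.
pose X (s : nat -> R) : 'rV[R]_d := \row_(i < d) s (nat_of_ord i).
pose F (v : R) (s t : nat -> R) : \bar R :=
  ((\1_[set t | 0 <= v <= f t]%classic (sqnorm (X s - X t)) : R)
    * (rho (X s) * rho (X t)))%:E.
have F0 v s t : (0 <= F v s t)%E by rewrite lee_fin !mulr_ge0.
have mX d' (T : measurableType d') (s : T -> nat -> R) :
  (forall n, measurable_fun setT (fun z => s z n)) ->
  forall i, measurable_fun setT (fun z => X (s z) ord0 i).
  by move=> ms i; under eq_fun do rewrite mxE; exact: ms.
have mF d' (T : measurableType d') (v : T -> R) (s t : T -> nat -> R) :
  measurable_fun setT v ->
  (forall n, measurable_fun setT (fun z => s z n)) ->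
  (forall n, measurable_fun setT (fun z => t z n)) ->
  measurable_fun setT (fun z => F (v z) (s z) (t z)).
  move=> mv ms mt; apply/measurable_EFinP; apply: measurable_funM; last first.
    by apply: measurable_funM; apply: mrho; exact: mX.
  under eq_fun do rewrite indic_layer.
  apply: measurable_indic_itv0 => //; apply: measurableT_comp => //.
  by apply: measurable_sqnormB; exact: mX.
(* The integral over the level [v] moves inside, past the integral over the first point and then
   past the one over the second. *)
rewrite (integral_iint d (fun v s => iint d (F v s))); last 2 first.
- by move=> v s; exact: iint_ge0.
- move=> d' T' a s ma ms; apply: (measurable_iint d (fun z => F (a z) (s z))) => //.
  move=> d2 T2 b t mb mt; apply: mF; [|move=> n|exact: mt].
    exact: (measurableT_comp ma mb).
  exact: (measurableT_comp (ms n) mb).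
apply: eq_iint => s; rewrite (integral_iint d (fun v => F v s)) //; last first.
  by move=> d' T' a t ma mt; apply: mF => // n; exact: measurable_cst.
apply: eq_iint => t; rewrite /F.
set c := rho (X s) * rho (X t); set r := sqnorm _.
have c0 : 0 <= c by rewrite mulr_ge0.
transitivity (\int[@lebesgue_measure R]_v (c%:E * (\1_(`[0%R, f r]%classic : set R) v)%:E))%E.
  rewrite ge0_integralZl_EFin//; last by apply/measurable_EFinP; apply: measurable_indic.
  rewrite integral_indic// setIT/= lebesgue_measure_itv/= lte_fin.
  (* When [f r = 0] the interval is a single point and both sides vanish. *)
  case: ltgtP (f0 r) => // [fr _|<- _]; last by rewrite mul0r mule0.
  by rewrite mulrC EFinM oppr0 adde0.
by apply: eq_integral => v _; rewrite -EFinM mulrC indic_layer.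
Qed.

(** * Gaussian integrals *)

Lemma ge0_integral_sumZ {R : realType} (J : finType) (c : J -> R)
    (h : J -> R -> R) (I : J -> R) :
  (forall j, 0 <= c j) -> (forall j t, 0 <= h j t) ->
  (forall j, measurable_fun setT (h j)) ->
  (forall j, \int[@lebesgue_measure R]_t (h j t)%:E = (I j)%:E)%E ->
  (\int[@lebesgue_measure R]_t (\sum_j c j * h j t)%:E =
   (\sum_j c j * I j)%:E)%E.
Proof.
move=> c0 h0 mh hI.
under eq_integral do rewrite -sumEFin.
rewrite ge0_integral_sum//; last 2 first.
- by move=> j; apply/measurable_EFinP; apply: measurable_funM => //; exact: mh.
- by move=> j t _; rewrite lee_fin mulr_ge0.
rewrite -sumEFin; apply: eq_bigr => j _.
under eq_integral do rewrite EFinM.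
rewrite ge0_integralZl_EFin//; last 2 first.
- by move=> t _; rewrite lee_fin.
- by apply/measurable_EFinP; exact: mh.
by rewrite hI.
Qed.

(** One coordinate is integrated at a time, the factors not depending on it being absorbed into the
    coefficients, which stay nonnegative. *)
Lemma iint_sum_prod {R : realType} n (J : finType) (c : J -> R)
    (h : J -> 'I_n -> R -> R) (I : J -> 'I_n -> R) :
  (forall j, 0 <= c j) -> (forall j i t, 0 <= h j i t) ->
  (forall j i, measurable_fun setT (h j i)) ->
  (forall j i, \int[@lebesgue_measure R]_t (h j i t)%:E = (I j i)%:E)%E ->
  iint n (fun s => (\sum_j c j * \prod_(i < n) h j i (s i))%:E) =
  (\sum_j c j * \prod_(i < n) I j i)%:E.
Proof.
elim: n c h I => [|n IH] c h I c0 h0 mh hI.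
  by rewrite /=; congr _%:E; apply: eq_bigr => j _; rewrite !big_ord0.
have I0 j i : 0 <= I j i.
  by rewrite -lee_fin -hI; apply: integral_ge0 => t _; rewrite lee_fin.
transitivity (\int[@lebesgue_measure R]_t
    (\sum_j (c j * \prod_(i < n) I j (lift ord0 i)) * h j ord0 t)%:E)%E.
  apply: eq_integral => t _.
  transitivity (iint n (fun s => (\sum_j (c j * h j ord0 t)
      * \prod_(i < n) h j (lift ord0 i) (s i))%:E)).
    apply: eq_iint => s; congr _%:E; apply: eq_bigr => j _.
    by rewrite big_ord_recl mulrA.
  rewrite (IH _ (fun j i => h j (lift ord0 i)) (fun j i => I j (lift ord0 i))) //.
    by congr _%:E; apply: eq_bigr => j _; rewrite mulrAC.
  by move=> j; rewrite mulr_ge0.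
rewrite (ge0_integral_sumZ _ _ _ (fun j => I j ord0)) //.
  congr _%:E; apply: eq_bigr => j _; rewrite big_ord_recl -mulrA; congr (_ * _).
  exact: mulrC.
by move=> j; rewrite mulr_ge0// prodr_ge0.
Qed.

Lemma rint_sum_prod {R : realType} n (J : finType) (c : J -> R)
    (h : J -> 'I_n -> R -> R) (I : J -> 'I_n -> R) :
  (forall j, 0 <= c j) -> (forall j i t, 0 <= h j i t) ->
  (forall j i, measurable_fun setT (h j i)) ->
  (forall j i, \int[@lebesgue_measure R]_t (h j i t)%:E = (I j i)%:E)%E ->
  rint (fun x : 'rV[R]_n => (\sum_j c j * \prod_(i < n) h j i (x ord0 i))%:E) =
  (\sum_j c j * \prod_(i < n) I j i)%:E.
Proof.
move=> c0 h0 mh hI; rewrite -(iint_sum_prod _ _ _ h)//; apply: eq_iint => s.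
by congr _%:E; apply: eq_bigr => j _; under eq_bigr do rewrite mxE.
Qed.

Lemma eq_rint {R : realType} n (f g : 'rV[R]_n -> \bar R) :
  f =1 g -> rint f = rint g.
Proof. by move=> /funext ->. Qed.

(** Completing the square in [t] leaves a multiple of the normal density of mean
    [(2 * s * x + b) / (1 + 2 * s)] and variance [1 / (1 + 2 * s)]. *)
Lemma integral_gauss {R : realType} (s x b : R) : 0 <= s ->
  (\int[@lebesgue_measure R]_t
     (expR (- s * (x - t) ^+ 2) * expR (- ((t - b) ^+ 2) / 2))%:E =
   (Num.sqrt (pi *+ 2 / (1 + 2 * s)) * expR (- (s / (1 + 2 * s)) * (x - b) ^+ 2))%:E)%E.
Proof.
move=> s0; have u0 : 0 < 1 + 2 * s by lra.
pose sigma := Num.sqrt ((1 + 2 * s)^-1).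
have sigma2 : sigma ^+ 2 = (1 + 2 * s)^-1 by rewrite sqr_sqrtr// invr_ge0 ltW.
have sigma0 : sigma != 0 by rewrite gt_eqF// sqrtr_gt0 invr_gt0.
pose m := (2 * s * x + b) / (1 + 2 * s).
have pkE : normal_peak sigma = (Num.sqrt (pi *+ 2 / (1 + 2 * s)))^-1.
  by rewrite /normal_peak sigma2 -mulrnAr mulrC.
have pk0 : normal_peak sigma != 0 by rewrite gt_eqF// normal_peak_gt0.
set A := Num.sqrt _ in pkE *.
set E := expR _.
have AE : A = (normal_peak sigma)^-1 by rewrite pkE invrK.
transitivity (\int[@lebesgue_measure R]_t ((A * E)%:E * (normal_pdf m sigma t)%:E))%E.
  apply: eq_integral => t _; rewrite -EFinM; congr _%:E.
  rewrite normal_pdfE// /normal_fun AE mulrACA mulVf// mul1r /E -!expRD; congr expR.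
  rewrite sigma2 /m; field; lra.
rewrite ge0_integralZl_EFin//.
- by rewrite integral_normal_pdf mule1.
- by move=> t _; rewrite lee_fin normal_pdf_ge0.
- by apply/measurable_EFinP; exact: measurable_normal_pdf.
- by rewrite mulr_ge0 ?expR_ge0 ?sqrtr_ge0.
Qed.

(** * Laplace transform of the squared distance for a mixture *)

Lemma expR_sqnormB {R : realType} d (a : R) (x y : 'rV[R]_d) :
  expR (a * sqnorm (x - y)) =
  \prod_(i < d) expR (a * (x ord0 i - y ord0 i) ^+ 2).
Proof.
rewrite /sqnorm mulr_sumr expR_sum; apply: eq_bigr => i _.
by rewrite !mxE.
Qed.

Lemma gmixE {R : realType} d k (w : 'I_k -> R) (m : 'I_k -> 'rV[R]_d) x :
  gmix w m x = \sum_(i < k) w i / Num.sqrt ((2 * pi) ^+ d) *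
    \prod_(c < d) expR (- ((x ord0 c - m i ord0 c) ^+ 2) / 2).
Proof.
apply: eq_bigr => i _; congr (_ * _).
rewrite mulNr mulrC -mulNr expR_sqnormB; apply: eq_bigr => c _.
by congr expR; rewrite mulNr mulrC mulNr.
Qed.

(** Integrating a Gaussian of rate [s] against the mixture gives Gaussians of rate
    [s / (1 + 2 * s)]. The family [J] allows two uses: a single centre for the inner integral, all
    the means for the outer one. *)
Lemma rint_gauss_gmix {R : realType} d k (w : 'I_k -> R) (m : 'I_k -> 'rV[R]_d)
    (s : R) (J : finType) (c : J -> R) (v : J -> 'rV[R]_d) :
  0 <= s -> (forall j, 0 <= c j) -> (forall i, 0 < w i) ->
  rint (fun x => (\sum_j c j * expR (- s * sqnorm (v j - x)) * gmix w m x)%:E) =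
  (\sum_(p : J * 'I_k) (Num.sqrt (pi *+ 2 / (1 + 2 * s)) ^+ d
      / Num.sqrt ((2 * pi) ^+ d))
    * (c p.1 * w p.2) * expR (- (s / (1 + 2 * s)) * sqnorm (v p.1 - m p.2)))%:E.
Proof.
move=> s0 c0 w0; set Z := Num.sqrt ((2 * pi) ^+ d).
have Z0 : 0 <= Z^-1 by rewrite invr_ge0 sqrtr_ge0.
pose h (p : J * 'I_k) (i : 'I_d) (t : R) : R :=
  expR (- s * (v p.1 ord0 i - t) ^+ 2) * expR (- ((t - m p.2 ord0 i) ^+ 2) / 2).
transitivity (rint (fun x : 'rV[R]_d =>
  (\sum_(p : J * 'I_k) (c p.1 * (w p.2 / Z)) *
    \prod_(i < d) h p i (x ord0 i))%:E)).
  apply: eq_rint => x; congr _%:E.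
  rewrite -(pair_bigA _ (fun j l => c j * (w l / Z) * \prod_(i < d) h (j, l) i (x ord0 i))) /=.
  apply: eq_bigr => j _; rewrite gmixE mulr_sumr; apply: eq_bigr => l _.
  by rewrite big_split/= expR_sqnormB mulrACA.
rewrite (rint_sum_prod _ _ _ h (fun p i => Num.sqrt (pi *+ 2 / (1 + 2 * s))
   * expR (- (s / (1 + 2 * s)) * (v p.1 ord0 i - m p.2 ord0 i) ^+ 2))).
- congr _%:E; apply: eq_bigr => p _.
  rewrite big_split/= prodr_const card_ord expR_sqnormB.
  by rewrite !mulrA; congr (_ * _); rewrite -/Z; ring.
- by move=> p; rewrite !mulr_ge0// ltW.
- by move=> p i t; rewrite mulr_ge0 ?expR_ge0.
- move=> p i; apply: measurable_funM; apply: measurableT_comp => //;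
    apply: measurable_funM => //.
  + by apply: measurable_funX; exact: measurable_funB.
  + by apply: measurableT_comp => //; apply: measurable_funX; exact: measurable_funB.
- by move=> p i; exact: integral_gauss.
Qed.

(** [C] is chosen before the mixture, so that it cancels when two mixtures are compared. *)
Lemma laplace_gmix {R : realType} d (s : R) : 0 <= s -> exists2 C : R, C != 0 &
  forall k (w : 'I_k -> R) (m : 'I_k -> 'rV[R]_d), (forall i, 0 < w i) ->
  rint (fun x => rint (fun y =>
    (expR (- s * sqnorm (x - y)) * (gmix w m x * gmix w m y))%:E)) =
  (C * \sum_(p : 'I_k * 'I_k) w p.1 * w p.2 *
     expR (- (s / (1 + 4 * s)) * sqnorm (m p.1 - m p.2)))%:E.
Proof.
move=> s0; pose s' := s / (1 + 2 * s).
have u0 : 0 < 1 + 2 * s by lra.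
have s'0 : 0 <= s' by rewrite divr_ge0// ltW.
have u'0 : 0 < 1 + 2 * s' by lra.
pose K (r : R) := Num.sqrt (pi *+ 2 / (1 + 2 * r)) ^+ d / Num.sqrt ((2 * pi) ^+ d).
have K0 r : 0 < 1 + 2 * r -> 0 < K r.
  move=> r0; apply: divr_gt0; last by rewrite sqrtr_gt0 exprn_gt0// mulr_gt0// pi_gt0.
  by rewrite exprn_gt0// sqrtr_gt0 divr_gt0// pmulrn_lgt0// pi_gt0.
exists (K s * K s'); first by rewrite mulf_neq0// gt_eqF// K0.
move=> k w m w0.
transitivity (rint (fun x => (\sum_j (K s * w j) * expR (- s' * sqnorm (m j - x))
    * gmix w m x)%:E)).
  apply: eq_rint => x.
  transitivity (rint (fun y => (\sum_(j : 'I_1) gmix w m x *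
      expR (- s * sqnorm (x - y)) * gmix w m y)%:E)).
    by apply: eq_rint => y; rewrite big_ord1; congr _%:E; ring.
  rewrite (rint_gauss_gmix _ _ w m s _ (fun=> gmix w m x) (fun=> x))//; last first.
    by move=> _; exact: gmix_ge0.
  congr _%:E.
  rewrite -(pair_bigA _ (fun (j : 'I_1) l => K s * (gmix w m x * w l)
    * expR (- s' * sqnorm (x - m l)))) /= big_ord1.
  by apply: eq_bigr => l _; rewrite sqnormBC; ring.
rewrite rint_gauss_gmix//; last by move=> j; rewrite mulr_ge0// ltW// K0.
congr _%:E; rewrite mulr_sumr; apply: eq_bigr => p _; rewrite -/(K s').
(* The two integrations compose the map [s |-> s / (1 + 2 * s)] with itself. *)
have -> : s' / (1 + 2 * s') = s / (1 + 4 * s) by rewrite /s'; field; lra.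
by ring.
Qed.

(** * Exponential sums *)

Lemma sum_horner_vanish {R : fieldType} (J : finType) (T : eqType) (c : J -> R)
    (a : J -> T) (e : T -> R) (p : {poly R}) (l : T) :
  (forall j, a j != l -> p.[e (a j)] = 0) ->
  \sum_j c j * p.[e (a j)] = p.[e l] * \sum_(j | a j == l) c j.
Proof.
move=> p0; rewrite (bigID (fun j => a j == l))/= addrC big1 ?add0r.
  by rewrite mulr_sumr; apply: eq_bigr => j /eqP ->; rewrite mulrC.
by move=> j /p0 ->; rewrite mulr0.
Qed.

(* Evaluating at [u = n h] turns exponential sums into power sums in the nodes
   [exp (- h v)]; the polynomial vanishing at all nodes but one isolates the
   corresponding coefficient. *)
Lemma exp_sum_coef {R : realType} (b : R) (J J' : finType) (c a : J -> R) (c' a' : J' -> R) :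
  0 < b ->
  (forall u, 0 <= u < b ->
    \sum_j c j * expR (- u * a j) = \sum_j c' j * expR (- u * a' j)) ->
  forall l, \sum_(j | a j == l) c j = \sum_(j | a' j == l) c' j.
Proof.
move=> b0 H l.
pose S := [seq v <- codom a ++ codom a' | v != l].
(* [p] has degree [size S], hence [N] coefficients; the step [h = b / N] keeps all sample points
   [n * h] with [n < N] below [b]. *)
pose N := (size S).+1.
pose h := b / N%:R.
have h0 : 0 < h by rewrite divr_gt0// ltr0n.
pose e v := expR (- h * v).
pose p := \prod_(v <- S) ('X - (e v)%:P).
have sp : size p = N by rewrite size_prod_XsubC.
have pS v : v \in S -> p.[e v] = 0.
  move=> vS; apply/rootP; rewrite /p -(big_map e predT (fun x => 'X - x%:P)).
  by rewrite root_prod_XsubC; apply: map_f.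
have pl : p.[e l] != 0.
  rewrite -rootE /p -(big_map e predT (fun x => 'X - x%:P)) root_prod_XsubC.
  apply/mapP => -[v]; rewrite mem_filter => /andP[/eqP vl _] /expR_inj.
  by move=> /mulfI E; apply: vl; rewrite E// oppr_eq0 gt_eqF.
have key : \sum_j c j * p.[e (a j)] = \sum_j c' j * p.[e (a' j)].
  have expand (K : finType) (f g : K -> R) : \sum_j f j * p.[e (g j)] =
      \sum_(n < N) p`_n * \sum_j f j * expR (- (h * n%:R) * g j).
    under eq_bigr do rewrite horner_coef sp mulr_sumr.
    rewrite exchange_big/=; apply: eq_bigr => n _; rewrite mulr_sumr.
    apply: eq_bigr => j _; rewrite mulrCA; congr (_ * (_ * _)).
    by rewrite /e -expRM_natl; congr expR; ring.
  rewrite !expand; apply: eq_bigr => n _; rewrite H//.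
  rewrite mulr_ge0 ?ler0n ?(ltW h0)//= /h mulrAC ltr_pdivrMr ?ltr0n//.
  by rewrite ltr_pM2l// ltr_nat.
apply: (mulfI pl).
rewrite -(sum_horner_vanish _ _ c a e) => [|j jl]; last first.
  by apply: pS; rewrite mem_filter jl mem_cat codom_f.
rewrite -(sum_horner_vanish _ _ c' a' e) // => j jl.
by apply: pS; rewrite mem_filter jl mem_cat codom_f orbT.
Qed.

(** * Pairs at a given distance *)

Section Weights.
Context {R : realType} {d k : nat} (mu : 'I_k -> 'rV[R]_d).
Hypotheses (hk : (2 < k)%N) (hdist : distinct_dists mu).

Lemma ord_avoid2 (i j : 'I_k) : exists l : 'I_k, l != i /\ l != j.
Proof.
have /card_gt0P[l] : (0 < #|predC (pred2 i j)|)%N.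
  rewrite -(ltn_add2l #|pred2 i j|) cardC card_ord addn0 card2.
  by apply: leq_ltn_trans hk; case: (i != j).
by rewrite !inE negb_or => /andP[]; exists l.
Qed.

(** [distinct_dists] only concerns increasing pairs; symmetry of the distance covers the other
    orders. *)
Lemma dist_inj (i j a b : 'I_k) : i != j -> a != b ->
  sqnorm (mu a - mu b) = sqnorm (mu i - mu j) ->
  (a, b) = (i, j) \/ (a, b) = (j, i).
Proof.
have wl (i0 j0 a0 b0 : 'I_k) : (i0 < j0)%N -> (a0 < b0)%N ->
    sqnorm (mu a0 - mu b0) = sqnorm (mu i0 - mu j0) -> (a0, b0) = (i0, j0).
  move=> ij ab /eqP; rewrite -edist_eqE => /eqP E.
  by have [-> ->] := hdist _ _ _ _ ab ij E.
rewrite -!val_eqE !neq_ltn => /orP[ij|ij] /orP[ab|ab] E.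
- by left; exact: wl.
- by rewrite sqnormBC in E; have [-> ->] := wl _ _ _ _ ij ab E; right.
- by rewrite [RHS]sqnormBC in E; have [-> ->] := wl _ _ _ _ ij ab E; right.
- by rewrite sqnormBC [RHS]sqnormBC in E; have [-> ->] := wl _ _ _ _ ij ab E; left.
Qed.

(** If two means coincided, a third one would be equidistant from both, against distinctness. *)
Lemma dist_neq0 (i j : 'I_k) : i != j -> sqnorm (mu i - mu j) != 0.
Proof.
move=> ij; apply/eqP => /eqP; rewrite sqnorm_eq0 subr_eq0 => /eqP E.
have [l [li lj]] := ord_avoid2 i j.
have il : i != l by rewrite eq_sym.
have jl : j != l by rewrite eq_sym.
have D : sqnorm (mu j - mu l) = sqnorm (mu i - mu l) by rewrite E.
have [[ji]|[_ li']] := dist_inj _ _ _ _ il jl D.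
  by rewrite ji eqxx in ij.
by rewrite li' eqxx in li.
Qed.

(** Only [(i, j)] and [(j, i)] contribute: diagonal pairs are at distance zero, which [dist_neq0]
    rules out. *)
Lemma sum_pair_dist (f : 'I_k -> R) (i j : 'I_k) : i != j ->
  \sum_(p : 'I_k * 'I_k | sqnorm (mu p.1 - mu p.2) == sqnorm (mu i - mu j))
     f p.1 * f p.2 = (f i * f j) *+ 2.
Proof.
move=> ij; rewrite (bigD1 (i, j))//= (bigD1 (j, i))/=; last first.
  by rewrite sqnormBC eqxx xpair_eqE negb_and eq_sym ij.
rewrite big1 ?addr0; first by rewrite mulr2n [f j * _]mulrC.
move=> [a b]/= /andP[/andP[/eqP E n1] n2].
have [ab|ab] := eqVneq a b; last first.
  by case: (dist_inj _ _ _ _ ij ab E) => p; rewrite p eqxx in n1 n2.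
have := dist_neq0 _ _ ij; rewrite -E ab sqnorm_eq0 subrr eqxx //.
Qed.

(** With three distinct indices, [f i ^+ 2] is [(f j * f i) * (f l * f i) / (f l * f j)], and
    positivity fixes the root. *)
Lemma weights_eq (f g : 'I_k -> R) :
  (forall i, 0 < f i) -> (forall i, 0 < g i) ->
  (forall i j, i != j -> f i * f j = g i * g j) -> f =1 g.
Proof.
move=> f0 g0 fg i.
have [j [ji _]] := ord_avoid2 i i.
have [l [li lj]] := ord_avoid2 i j.
have fn x : f x != 0 by rewrite gt_eqF.
have gn x : g x != 0 by rewrite gt_eqF.
have E : f i ^+ 2 = g i ^+ 2.
  have -> : f i ^+ 2 = (f j * f i) * (f l * f i) / (f l * f j) by field; rewrite !fn.
  by rewrite !fg//; field; rewrite !gn.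
by apply/eqP; rewrite -(eqrXn2 (n := 2)) ?ltW// E.
Qed.

End Weights.

(** Inclusion suffices: the distances of [mu] form a duplicate-free list, and that of [nu] has the
    same length, so it can contain neither repetitions nor further values. *)
Lemma perm_pair_dists {R : realType} d k (mu nu : 'I_k -> 'rV[R]_d) :
  distinct_dists mu ->
  (forall i j, i != j -> exists a b, a != b /\
    sqnorm (nu a - nu b) = sqnorm (mu i - mu j)) ->
  perm_eq (pair_dists mu) (pair_dists nu).
Proof.
move=> hdist H; rewrite /pair_dists; set s := enum _.
have us : uniq [seq Defs.edist (mu ij.1) (mu ij.2) | ij <- s].
  rewrite map_inj_in_uniq ?enum_uniq// => -[i j] [i' j'].
  rewrite !mem_enum !inE /= => ij ij' E.
  by have [-> ->] := hdist _ _ _ _ ij ij' E.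
have sub : {subset [seq Defs.edist (mu ij.1) (mu ij.2) | ij <- s] <=
    [seq Defs.edist (nu ij.1) (nu ij.2) | ij <- s]}.
  move=> z /mapP[[i j]]; rewrite mem_enum inE /= => ij -> {z}.
  have [|a [b [ab E]]] := H i j; first by rewrite -val_eqE neq_ltn ij.
  have ED : Defs.edist (mu i) (mu j) = Defs.edist (nu a) (nu b) by apply/eqP; rewrite edist_eqE E.
  move: ab; rewrite -val_eqE neq_ltn => /orP[ab|ab]; apply/mapP.
    by exists (a, b); rewrite ?mem_enum.
  exists (b, a); rewrite ?mem_enum//= ED.
  by apply/eqP; rewrite edist_eqE sqnormBC.
have [|E uE] := uniq_min_size us sub; first by rewrite !size_map.
by apply: uniq_perm => //; rewrite -(eq_uniq E uE).
Qed.

(** * Comparison of the two mixtures *)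

Lemma gmix_rigid {R : realType} d k (w wb : 'I_k -> R) (mu nu : 'I_k -> 'rV[R]_d)
    (g : 'rV[R]_d -> 'rV[R]_d) (s : 'S_k) x :
  rigid_motion g -> (forall i, g (mu (s i)) = nu i) -> (forall i, w (s i) = wb i) ->
  gmix w mu x = gmix wb nu (g x).
Proof.
move=> gr gE wE; rewrite /gmix (reindex_inj (@perm_inj _ s)).
by apply: eq_bigr => i _; rewrite wE -gE sqnorm_rigid.
Qed.

Lemma laplace_gmix_eq {R : realType} d k (w wb : 'I_k -> R) (mu nu : 'I_k -> 'rV[R]_d) :
  (forall i, 0 < w i) -> (forall i, 0 < wb i) ->
  (forall A : set (measurableTypeR R), measurable A ->
     dist_of_dists (gmix w mu) A = dist_of_dists (gmix wb nu) A) ->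
  forall u, 0 <= u < 4^-1 ->
  \sum_(p : 'I_k * 'I_k) w p.1 * w p.2 * expR (- u * sqnorm (mu p.1 - mu p.2)) =
  \sum_(p : 'I_k * 'I_k) wb p.1 * wb p.2 * expR (- u * sqnorm (nu p.1 - nu p.2)).
Proof.
move=> w0 wb0 H u /andP[u0 u4].
have v0 : 0 < 1 - 4 * u by lra.
(* Inverse of [s |-> s / (1 + 4 * s)], which maps the nonnegative reals onto [[0, 1/4[]. *)
pose s := u / (1 - 4 * u).
have s0 : 0 <= s by rewrite divr_ge0// ltW.
have su : s / (1 + 4 * s) = u by rewrite /s; field; lra.
have [C C0 CE] := laplace_gmix d s s0.
have mf : measurable_fun setT (fun t : R => expR (- s * t)).
  by apply: measurableT_comp => //; exact: measurable_funM.
have f0 (t : R) : 0 <= expR (- s * t) by exact: expR_ge0.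
have L (w' : 'I_k -> R) (m' : 'I_k -> 'rV[R]_d) : (forall i, 0 < w' i) ->
    (C * \sum_(p : 'I_k * 'I_k) w' p.1 * w' p.2 *
      expR (- u * sqnorm (m' p.1 - m' p.2)))%:E =
    (\int[@lebesgue_measure R]_v dist_of_dists (gmix w' m')
      ([set t | (0 <= v <= expR (- s * t))%R]%classic : set (measurableTypeR R)))%E.
  move=> w'0; rewrite -(layer_cake d (gmix w' m') (fun t => expR (- s * t)))//.
  - by rewrite CE// su.
  - by move=> x; exact: gmix_ge0.
  - by move=> d' T x; exact: measurable_gmix.
apply: (mulfI C0); apply: EFin_inj; rewrite (L w mu w0) (L wb nu wb0).
(* For each level [v] the layer is a Borel set, on which the two laws agree. *)
apply: eq_integral => v _; apply: H.
rewrite (_ : [set t | _]%classic = ([set t | 0 <= v] `&` [set t | v <= expR (- s * t)])%classic).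
  by apply: measurableI; rewrite -[X in measurable X]setTI; apply: measurable_fun_le.
by apply/seteqP; split => t /= => [/andP[]|[-> ->]].
Qed.

Theorem theorem4p1 (R : realType) (d k : nat) (hd : (1 <= d)%N) (hk : (d + 2 <= k)%N)
  (w : 'I_k -> R) (mu : 'I_k -> 'rV[R]_d)
  (hw : forall i, 0 < w i) (hw1 : \sum_(i < k) w i = 1)
  (hdist : distinct_dists mu) (hrec : reconstructible mu)
  (wb : 'I_k -> R) (nu : 'I_k -> 'rV[R]_d)
  (hwb : forall i, 0 < wb i) (hwb1 : \sum_(i < k) wb i = 1)
  (hsame : forall A : set (measurableTypeR R), measurable A ->
     dist_of_dists (gmix w mu) A = dist_of_dists (gmix wb nu) A) :
  exists g : 'rV[R]_d -> 'rV[R]_d, rigid_motion g /\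
    forall x, gmix w mu x = gmix wb nu (g x).
Proof.
have k3 : (2 < k)%N by apply: leq_trans hk; rewrite addn2 !ltnS.
have q0 : 0 < 4^-1 :> R by rewrite invr_gt0.
have coef := exp_sum_coef _ _ _ _ _ _ _ q0 (laplace_gmix_eq _ _ _ _ _ _ hw hwb hsame).
have [|g [gr [s gE]]] := hrec nu.
  apply: perm_pair_dists => // i j ij.
  have := coef (sqnorm (mu i - mu j)).
  rewrite (sum_pair_dist _ k3 hdist)// => E.
  (* The coefficient at this distance is [2 * w i * w j > 0]; were no pair of [nu] to realize it,
     the other side would be an empty sum. *)
  have [/existsP[[a b] /= /eqP ab]|/existsPn none] := boolP [exists p : 'I_k * 'I_k,
      sqnorm (nu p.1 - nu p.2) == sqnorm (mu i - mu j)].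
    exists a, b; split => //; apply/eqP => eab.
    have := dist_neq0 _ k3 hdist _ _ ij.
    by rewrite -ab eab subrr sqnorm_eq0 eqxx.
  move: E; rewrite big_pred0 => [|p]; last exact/negbTE/none.
  by move/eqP; rewrite mulrn_eq0/= mulf_eq0 !gt_eqF.
exists g; split => // x; apply: (gmix_rigid _ _ _ _ _ _ g s) => // i.
(* The weights [wb] are relabelled by the inverse of [s], so as to be indexed like [mu]. *)
rewrite -[in RHS](permK s i); move: (s i) => {}i.
apply: (weights_eq k3 w (fun i => wb (s^-1%g i))) => // {}i j ij.
have := coef (sqnorm (mu i - mu j)).
rewrite (sum_pair_dist _ k3 hdist)//.
pose t p : 'I_k * 'I_k := (s^-1%g p.1, s^-1%g p.2).
have tinj : injective t by move=> [a b] [a' b'] [/perm_inj -> /perm_inj ->].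
(* After this relabelling the means [nu] become [g (mu i)]; as [g] is an isometry, the right-hand
   sum also runs over pairs of [mu] at the given distance. *)
rewrite [RHS](reindex_inj tinj)/=.
under [RHS]eq_bigl => p do rewrite -!gE !permKV sqnorm_rigid//.
rewrite (sum_pair_dist _ k3 hdist (fun i => wb (s^-1%g i)))//.
by move/eqP; rewrite eqrMn2r /= => /eqP.
Qed.
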